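(* Let $n\in\{2,3\}$ and let $(M^n,\mathcal T)$ be a closed triangulated $n$-manifold with vertices $1,\dots,N$ (with a fixed weight $\Phi:\mathcal T_1\to[0,\frac{\pi}{2}]$ on edges if $n=2$). Let $\alpha,\beta\in\mathbb R$ and let $r(t)$ be a solution, in $\mathbb R^N_{>0}$ if $n=2$ and in $\mathfrak M_{\mathcal T}$ if $n=3$, of the $(\alpha,\beta)$-flow $$\frac{dr_i}{dt}=s_\alpha r_i^{\beta}-K_i r_i^{\beta-\alpha},\qquad i=1,\dots,N,\qquad s_\alpha=\frac{\sum_{i=1}^N K_i r_i^{n-2}}{\sum_{i=1}^N r_i^{\alpha+n-2}}.$$ Let $\delta=\alpha-\beta+n-1$. If $\delta\ne0$, then $\sum_{i=1}^N r_i^{\delta}(t)$ is constant in $t$ along the flow. If $\delta=0$, then $\prod_{i=1}^N r_i(t)$ is constant in $t$ along the flow.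
   Context: A triangulated $n$-manifold $(M^n,\mathcal T)$ is a closed $n$-manifold with a triangulation $\mathcal T=\{\mathcal T_0,\dots,\mathcal T_n\}$, $\mathcal T_i$ being the set of $i$-simplices; $N$ is the number of vertices. Case $n=2$ (Thurston's circle packing metrics). A weight $\Phi:\mathcal T_1\to[0,\frac{\pi}{2}]$ is fixed. A circle packing metric is a map $r:\mathcal T_0\to(0,+\infty)$, identified with $r\in\mathbb R^N_{>0}=(0,+\infty)^N$. Each edge $\{ij\}$ gets length $l_{ij}=\sqrt{r_i^2+r_j^2+2r_ir_j\cos\Phi_{ij}}$; it is known (Thurston) that the three lengths on each face satisfy the triangle inequalities, so each face is realized as a Euclidean triangle. With $\theta_i^{jk}$ the inner angle at vertex $i$ of the triangle $\{ijk\}$, the discrete Gauss curvature is $K_i=2\pi-\sum_{\{ijk\}\in\mathcal T_2}\theta_i^{jk}$, summed over all triangles having $i$ as a vertex. Case $n=3$ (Cooper–Rivin ball packing metrics). For $r\in\mathbb R^N_{>0}$ each edge $\{ij\}$ gets length $l_{ij}=r_i+r_j$. The map $r$ is a (non-degenerate) ball packing metric if for each $\{i,j,k,l\}\in\mathcal T_3$ the six lengths are the edge lengths of a non-degenerate Euclidean tetrahedron, equivalently $$Q_{ijkl}=\Big(\tfrac1{r_i}+\tfrac1{r_j}+\tfrac1{r_k}+\tfrac1{r_l}\Big)^2-2\Big(\tfrac1{r_i^2}+\tfrac1{r_j^2}+\tfrac1{r_k^2}+\tfrac1{r_l^2}\Big)>0.$$ $\mathfrak M_{\mathcal T}=\{r\in\mathbb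 R^N_{>0}: Q_{ijkl}>0\ \text{for all}\ \{i,j,k,l\}\in\mathcal T_3\}$. With $\alpha_{ijkl}$ the solid angle at vertex $i$ of the Euclidean tetrahedron $\{i,j,k,l\}$, the discrete scalar curvature is $K_i=4\pi-\sum_{\{i,j,k,l\}\in\mathcal T_3}\alpha_{ijkl}$, summed over all tetrahedra having $i$ as a vertex. *)

(* Defs.v *)
From HB Require Import structures.
From mathcomp Require Import all_boot all_order all_algebra.
From mathcomp Require Import all_classical all_reals all_analysis.

Set Implicit Arguments.
Unset Strict Implicit.
Unset Printing Implicit Defensive.
Import Order.TTheory GRing.Theory Num.Theory.
Import numFieldNormedType.Exports.
Local Open Scope classical_set_scope.
Local Open Scope ring_scope.

(* For sets A and B with the subspace topologies. *)
Definition homeomorphic (S T : topologicalType) (A : set S) (B : set T) : Prop :=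
  exists f : S -> T,
    [/\ set_bij A B f,
        {within A, continuous f} &
        forall U : set S, open U ->
          exists2 V : set T, open V & f @` (A `&` U) = B `&` V].

Definition closed_manifold (R : realType) (n : nat) (M : topologicalType) : Prop :=
  [/\ hausdorff_space M,
      @second_countable M,
      compact [set: M] &
      forall x : M, exists (U : set M) (W : set 'rV[R]_n),
        [/\ open U, U x, open W & homeomorphic U W]].

(* The empty simplex is not a member of T; every element of 'I_N is a vertex. *)
Definition simplicial_complex (N : nat) (T : {set {set 'I_N}}) : Prop :=
  [/\ finset.set0 \notin T,
      (forall i : 'I_N, [set i]%SET \in T) &
      forall s t : {set 'I_N},
        s \in T -> t \subset s -> t != finset.set0 -> t \in T].

Definition simplices (N : nat) (T : {set {set 'I_N}}) (d : nat) :
    {set {set 'I_N}} :=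
  [set s in T | #|s| == d.+1]%SET.

(* Barycentric coordinates with respect to the N vertices. *)
Definition polyhedron (R : realType) (N : nat) (T : {set {set 'I_N}}) :
    set 'rV[R]_N :=
  [set x | [/\ forall i, 0 <= x 0 i,
               \sum_i x 0 i = 1 &
               [set i | x 0 i != 0]%SET \in T]].

Definition triangulated_manifold (R : realType) (n N : nat)
    (M : topologicalType) (T : {set {set 'I_N}}) : Prop :=
  [/\ closed_manifold R n M,
      simplicial_complex T,
      forall s, s \in T -> (#|s| <= n.+1)%N &
      homeomorphic [set: M] (@polyhedron R N T)].

Section Euclidean.
Context {R : realType}.

Definition dotp (d : nat) (u v : 'rV[R]_d) : R := \sum_(k < d) u 0 k * v 0 k.

(* The library's norm on row vectors is the sup norm. *)
Definition enorm (d : nat) (u : 'rV[R]_d) : R := Num.sqrt (dotp u u).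

Definition is_placement (d N : nat) (l : 'I_N -> 'I_N -> R) (s : {set 'I_N})
    (p : 'I_N -> 'rV[R]_d) : Prop :=
  forall i j, i \in s -> j \in s -> i != j -> enorm (p i - p j) = l i j.

(* A Euclidean simplex with the prescribed edge lengths. It is unique up to
   isometry, so angles do not depend on the choice; it is the zero map when
   no such simplex exists. *)
Definition placement (d N : nat) (l : 'I_N -> 'I_N -> R) (s : {set 'I_N}) :
    'I_N -> 'rV[R]_d :=
  xget (fun=> 0) [set p | is_placement l s p].

Definition angle (d : nat) (a b c : 'rV[R]_d) : R :=
  acos (dotp (b - a) (c - a) / (enorm (b - a) * enorm (c - a))).

(* Independent of the order in which the other two vertices are listed. *)
Definition inner_angle (N : nat) (l : 'I_N -> 'I_N -> R) (s : {set 'I_N})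
    (i : 'I_N) : R :=
  let p := placement 2 l s in
  if enum (s :\ i)%SET is [:: j; k] then angle (p i) (p j) (p k) else 0.

Definition row3 (q : R * R * R) : 'rV[R]_3 :=
  \row_(k < 3) nth 0 [:: q.1.1; q.1.2; q.2] k.

Definition volume3 (A : set 'rV[R]_3) : \bar R :=
  ((@lebesgue_measure R \x @lebesgue_measure R) \x @lebesgue_measure R)%E
    (row3 @^-1` A).

Definition tangent_cone (N : nat) (s : {set 'I_N}) (p : 'I_N -> 'rV[R]_3)
    (i : 'I_N) : set 'rV[R]_3 :=
  [set x | exists2 c : 'I_N -> R, (forall j, 0 <= c j) &
     x = \sum_(j in (s :\ i)%SET) c j *: (p j - p i)].

(* The area of the part of the unit sphere lying in a cone is three times the
   volume of the part of the unit ball lying in that cone. *)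
Definition solid_angle (N : nat) (l : 'I_N -> 'I_N -> R) (s : {set 'I_N})
    (i : 'I_N) : R :=
  3 * fine (volume3
    (tangent_cone s (placement 3 l s) i `&` [set x | enorm x <= 1])).

End Euclidean.

Section Curvature.
Context {R : realType} {N : nat}.
Implicit Types (T : {set {set 'I_N}}) (Phi : {set 'I_N} -> R) (r : 'I_N -> R).

(* Phi matters only on edges. *)
Definition circle_length Phi r (i j : 'I_N) : R :=
  Num.sqrt (r i ^+ 2 + r j ^+ 2 + 2 * r i * r j * cos (Phi [set i; j]%SET)).

Definition gauss_curvature T Phi r (i : 'I_N) : R :=
  2 * pi - \sum_(s in simplices T 2 | i \in s)
             inner_angle (circle_length Phi r) s i.

Definition ball_length r (i j : 'I_N) : R := r i + r j.

Definition scalar_curvature T r (i : 'I_N) : R :=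
  4 * pi - \sum_(s in simplices T 3 | i \in s)
             solid_angle (ball_length r) s i.

Definition Qform r (s : {set 'I_N}) : R :=
  (\sum_(i in s) (r i)^-1) ^+ 2 - 2 * \sum_(i in s) (r i ^+ 2)^-1.

Definition ball_packing_metrics T : set ('I_N -> R) :=
  [set r | (forall i, 0 < r i) /\
           (forall s, s \in simplices T 3 -> 0 < Qform r s)].

(* The two definitions below are meant for n = 2 and n = 3 only. *)
Definition packing_metrics (n : nat) T : set ('I_N -> R) :=
  if n == 2 then [set r | forall i, 0 < r i] else ball_packing_metrics T.

Definition curvature (n : nat) T Phi r : 'I_N -> R :=
  if n == 2 then gauss_curvature T Phi r else scalar_curvature T r.

Definition s_alpha (n : nat) T Phi (alpha : R) r : R :=
  (\sum_i curvature n T Phi r i * r i ^+ (n - 2)) /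
  (\sum_i r i `^ (alpha + n%:R - 2)).

Definition flow_rhs (n : nat) T Phi (alpha beta : R) r (i : 'I_N) : R :=
  s_alpha n T Phi alpha r * r i `^ beta
  - curvature n T Phi r i * r i `^ (beta - alpha).

(* The derivative is one-sided at an end point of the time interval J. *)
Definition is_flow_solution (n : nat) T Phi (alpha beta : R) (J : interval R)
    (r : R -> 'I_N -> R) : Prop :=
  forall t, t \in J ->
    packing_metrics n T (r t) /\
    forall i, (r u i - r t i) / (u - t)
                @[u --> within [set u | u \in J /\ u != t] (nbhs t)]
              --> flow_rhs n T Phi alpha beta (r t) i.

End Curvature.

(* Main.v *)
(* Along the flow r_i^(delta-1) r_i' = s_alpha r_i^(alpha+n-2) - K_i r_i^(n-2), and
   s_alpha is exactly the constant making the sum of these over i vanish. That sum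
   is, up to the factor delta, the derivative of sum_i r_i^delta, and for delta = 0
   it is the derivative of sum_i ln r_i. *)
Require Import Defs.
From mathcomp Require Import all_boot all_order all_algebra.
From mathcomp Require Import all_classical all_reals all_analysis.
From mathcomp Require Import ring.
Import Order.TTheory GRing.Theory Num.Theory.
Import numFieldNormedType.Exports.
Local Open Scope classical_set_scope.
Local Open Scope ring_scope.

Lemma diff_quotient_cvg_within (R : realType) (A : set R) (f : R -> R) (x l : R) :
  (f u - f x) / (u - x) @[u --> within [set u | A u /\ u != x] (nbhs x)] --> l ->
  f u @[u --> within A (nbhs x)] --> f x.
Proof.
move=> fl.
set D := [set u | A u /\ u != x] in fl.
have ux : u - x @[u --> within D (nbhs x)] --> (0 : R).
  rewrite -(subrr x); apply: cvgB; last exact: cvg_cst.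
  by apply: cvg_within_filter; exact: cvg_id.
have fD : f u @[u --> within D (nbhs x)] --> f x.
  have : (f u - f x) / (u - x) * (u - x) + f x @[u --> within D (nbhs x)] --> f x.
    rewrite -[X in _ --> X]add0r -(mulr0 l).
    by apply: cvgD; [exact: cvgM | exact: cvg_cst].
  apply: cvg_trans; apply: near_eq_cvg.
  apply: filterS (near_withinT D _) => u [_ ux'].
  by rewrite divfK ?subr_eq0// subrK.
apply/cvgrPdist_lt => e e0.
have /cvgrPdist_lt/(_ e e0) := fD.
rewrite !near_withinE; apply: filterS => u + Au.
have [->|ux' h] := eqVneq u x; first by rewrite subrr normr0.
exact: h.
Qed.

Lemma diff_quotient_is_derive (R : realType) (A : set R) (f : R -> R) (x l : R) :
  nbhs x A ->
  (f u - f x) / (u - x) @[u --> within [set u | A u /\ u != x] (nbhs x)] --> l ->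
  is_derive x 1 f l.
Proof.
move=> xA fl.
have shx : h + x @[h --> (0 : R)^'] --> within [set u | A u /\ u != x] (nbhs x).
  move=> V; rewrite near_simpl near_withinE => DV.
  have hx : h + x @[h --> (0 : R)] --> x.
    rewrite -[X in _ --> X]add0r.
    by apply: cvgD; [exact: cvg_id | exact: cvg_cst].
  change (\forall h \near (0 : R), h != 0 -> V (h + x)).
  have : \forall h \near (0 : R), (A (h + x) /\ h + x != x -> V (h + x)) /\ A (h + x).
    exact: (hx _ (filterI DV xA)).
  apply: filterS => h [hV hA] h0.
  by apply: hV; split => //; rewrite -subr_eq0 addrK.
have hl : h^-1 *: ((f \o shift x) (h *: 1) - f x) @[h --> (0 : R)^'] --> l.
  have := cvg_comp _ _ shx fl.
  apply: cvg_trans; apply: near_eq_cvg; near=> h => /=.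
  by rewrite addrK scaler1 mulrC.
by apply: DeriveDef; [apply/cvg_ex; exists l | exact: cvg_lim].
Unshelve. all: by end_near. Qed.

Lemma sum_comp_constant (R : realType) (N : nat) (J : interval R)
    (r r' : R -> 'I_N -> R) (f f' : R -> R) :
  (forall t, t \in J -> forall i, 0 < r t i) ->
  (forall t, t \in J -> forall i,
     (r u i - r t i) / (u - t)
       @[u --> within [set u | u \in J /\ u != t] (nbhs t)] --> r' t i) ->
  (forall x : R, 0 < x -> is_derive x 1 f (f' x)) ->
  (forall t, t \in J -> \sum_i f' (r t i) * r' t i = 0) ->
  forall t u, t \in J -> u \in J -> \sum_i f (r t i) = \sum_i f (r u i).
Proof.
move=> r0 dr df sum0.
suff lt_case t u : t \in J -> u \in J -> t < u ->
    \sum_i f (r t i) = \sum_i f (r u i).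
  move=> t u tJ uJ; have [tu|ut|->//] := ltgtP t u; first exact: lt_case.
  by apply/esym; exact: lt_case.
move=> tJ uJ tu.
have subJ x : x \in `[t, u] -> x \in J.
  by rewrite in_itv/=; apply: (@interval_is_interval _ J t u tJ uJ).
have dF x : x \in `]t, u[ -> is_derive x 1 (\sum_(i < N) (f \o r^~ i))
    (\sum_i f' (r x i) * r' x i).
  move=> xtu; have xJ : x \in J by apply: subJ; exact: subset_itv_oo_cc.
  apply: is_derive_sum => i; apply: is_derive1_comp; first exact/df/r0.
  apply: (@diff_quotient_is_derive _ [set` J]); last exact: dr.
  have := near_in_itvoo xtu; apply: filterS => y ytu.
  by apply: subJ; exact: subset_itv_oo_cc.
have cF : {within `[t, u], continuous (\sum_(i < N) (f \o r^~ i))}.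
  apply/subspace_continuousP => x xtu; have xJ := subJ _ xtu.
  rewrite fct_sumE; apply: cvg_big => [|i _]; first exact: add_continuous.
  have rx : r y i @[y --> within `[t, u] (nbhs x)] --> r x i.
    apply: (@cvg_trans _ (r y i @[y --> within [set` J] (nbhs x)])).
      by apply: cvg_app; apply: within_subset => //; exact: subJ.
    by apply: diff_quotient_cvg_within; exact: dr.
  have fx : {for r x i, continuous f}.
    have [dfx _] := df _ (r0 _ xJ i).
    by apply: differentiable_continuous; exact/derivable1_diffP.
  exact: (cvg_comp _ _ rx fx).
have [c ctu] := MVT tu dF cF.
rewrite sum0 ?mul0r; last by apply: subJ; exact: subset_itv_oo_cc.
by rewrite !fct_sumE => /eqP; rewrite subr_eq0 => /eqP ->.
Qed.

Lemma packing_metrics_gt0 (R : realType) (n N : nat) (T : {set {set 'I_N}})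
    (r : 'I_N -> R) :
  packing_metrics n T r -> forall i, 0 < r i.
Proof. by rewrite /packing_metrics; case: ifP => _ => [|[]]. Qed.

Lemma sum_flow_rhs (R : realType) (n N : nat) (T : {set {set 'I_N}})
    (Phi : {set 'I_N} -> R) (alpha beta : R) (r : 'I_N -> R) :
  (1 < n)%N -> (forall i, 0 < r i) ->
  \sum_i r i `^ (alpha - beta + n%:R - 2) * flow_rhs n T Phi alpha beta r i = 0.
Proof.
move=> n1 r0.
have E i : r i `^ (alpha - beta + n%:R - 2) * flow_rhs n T Phi alpha beta r i =
    s_alpha n T Phi alpha r * r i `^ (alpha + n%:R - 2) -
    curvature n T Phi r i * r i ^+ (n - 2).
  have D a b c : a + b = c -> r i `^ a * r i `^ b = r i `^ c.
    by move=> <-; rewrite powRD// (gt_eqF (r0 i)) implybT.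
  rewrite /flow_rhs mulrBr mulrCA (D _ _ (alpha + n%:R - 2)); last by ring.
  rewrite mulrCA (D _ _ (n - 2)%:R); last by rewrite natrB//; ring.
  by rewrite powR_mulrn// ltW.
rewrite (eq_bigr _ (fun i _ => E i)) sumrB -mulr_sumr.
case: N T Phi r r0 {E} => [|N] T Phi r r0; first by rewrite !big_ord0 mulr0 subr0.
rewrite /s_alpha divfK ?subrr// gt_eqF// big_ord_recl ltr_pwDl ?powR_gt0//.
by apply: sumr_ge0 => i _; exact: powR_ge0.
Qed.

Theorem proposition4p1 (R : realType) (n N : nat) (M : topologicalType)
    (T : {set {set 'I_N}}) (Phi : {set 'I_N} -> R) (alpha beta : R)
    (J : interval R) (r : R -> 'I_N -> R)
    (hn : n = 2%N \/ n = 3%N)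
    (hT : triangulated_manifold R n M T)
    (hPhi : n = 2%N -> forall e, e \in simplices T 1 -> 0 <= Phi e <= pi / 2)
    (hr : is_flow_solution n T Phi alpha beta J r) :
  let delta := alpha - beta + n%:R - 1 in
  (delta != 0 -> forall t u, t \in J -> u \in J ->
     \sum_i r t i `^ delta = \sum_i r u i `^ delta) /\
  (delta = 0 -> forall t u, t \in J -> u \in J ->
     \prod_i r t i = \prod_i r u i).
Proof.
move=> delta.
have n1 : (1 < n)%N by case: hn => ->.
have r0 t : t \in J -> forall i, 0 < r t i.
  by move=> /hr[/packing_metrics_gt0].
have dr t (tJ : t \in J) := (hr t tJ).2.
have sum0 t : t \in J ->
    \sum_i r t i `^ (delta - 1) * flow_rhs n T Phi alpha beta (r t) i = 0.
  move=> /r0 rt0; rewrite -[RHS](sum_flow_rhs _ _ _ T Phi alpha beta _ n1 rt0).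
  by apply: eq_bigr => i _; congr (_ `^ _ * _); rewrite /delta; ring.
split=> [_|delta0].
- apply: (sum_comp_constant _ _ _ _ _ _ _ r0 dr (@is_derive1_powR R delta)).
  move=> t /sum0 t0 /=; under eq_bigr do rewrite -mulrA.
  by rewrite -mulr_sumr t0 mulr0.
- move=> t u tJ uJ.
  have prodE v : v \in J -> \prod_i r v i = expR (\sum_i ln (r v i)).
    by move=> vJ; rewrite expR_sum; apply: eq_bigr => i _; rewrite lnK// posrE r0.
  rewrite !prodE//; congr expR.
  apply: (sum_comp_constant _ _ _ _ _ _ _ r0 dr (@is_derive1_ln R)) => // v vJ.
  rewrite -[RHS](sum0 v vJ); apply: eq_bigr => i _.
  by rewrite delta0 sub0r powR_inv1// ltW// r0.
Qed.
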